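(* Let $X$ and $U$ be non-trivial complex Hilbert spaces with $\dim U<\infty$, let $A_s\in\mathcal L(X)$ and $B_s\in\mathcal L(U,X)$, and let $x_1=(x_1(k))_{k\in\mathbb N}$, $x_0=(x_0(k))_{k\in\mathbb N}$ be Bessel sequences in $X$ and $u_0=(u_0(k))_{k\in\mathbb N}$ a Bessel sequence in $U$ such that $x_1(k)=A_sx_0(k)+B_su_0(k)$ for all $k\in\mathbb N$. Let $\Xi_1,\Xi_0\in\mathcal L(\ell^2(\mathbb N),X)$ and $\Upsilon_0\in\mathcal L(\ell^2(\mathbb N),U)$ be the synthesis operators associated with $x_1,x_0,u_0$, respectively. Then for every fixed $\gamma\in(0,1)$ the following statements are equivalent: (i) The data $(x_1,x_0,u_0)$ are informative for stabilization with decay rate $\gamma$, and there exists a constant $c\ge0$ such that the following inequality on $\ell^2(\mathbb N)$ holds: $$\Xi_0^*\Xi_0\le c^2(\Xi_0^*\Xi_0)^2.$$ (ii) The sequence $x_0$ is a frame for $X$, and there exists a right inverse $\Xi_0^\dagger\in\mathcal L(X,\ell^2(\mathbb N))$ of $\Xi_0$ such that $\Xi_1\Xi_0^\dagger$ is power stable with decay rate $\gamma$.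
   Context: $\mathcal L(Y,Z)$ denotes the bounded linear operators from $Y$ to $Z$, $\mathcal L(Y)=\mathcal L(Y,Y)$; $\mathbb N=\{1,2,\dots\}$, $\mathbb N_0=\mathbb N\cup\{0\}$; $S\le T$ for self-adjoint operators means that $T-S$ is positive semidefinite. A sequence $(\eta_k)_{k\in\mathbb N}$ in a Hilbert space $Y$ is a Bessel sequence if there is $\alpha>0$ with $\sum_{k}|\langle y,\eta_k\rangle|^2\le\alpha\|y\|^2$ for all $y\in Y$; it is a frame for $Y$ if there are $\alpha,\beta>0$ with $\beta\|y\|^2\le\sum_k|\langle y,\eta_k\rangle|^2\le\alpha\|y\|^2$ for all $y\in Y$. The synthesis operator of a Bessel sequence is the bounded operator $\ell^2(\mathbb N)\to Y$, $w=(w_k)\mapsto\sum_{k=1}^\infty w_k\eta_k$. For $\gamma\in(0,1)$, a bounded operator $F$ is power stable with decay rate $\gamma$ if there is $M\ge1$ with $\|F^k\|\le M\gamma^k$ for all $k\in\mathbb N_0$. Define $\Sigma_{\mathrm{is}}:=\{(A,B)\in\mathcal L(X)\times\mathcal L(U,X): x_1(k)=Ax_0(k)+Bu_0(k)\ \text{for all }k\in\mathbb N\}$, and for $K\in\mathcal L(X,U)$, $M\ge1$, $\gamma>0$, $\Sigma_{K,M,\gamma}:=\{(A,B)\in\mathcal L(X)\times\mathcal L(U,X):\|(A+BK)^k\|\le M\gamma^k\ \text{for all }k\in\mathbb N_0\}$. For $\gamma\in(0,1)$, the data $(x_1,x_0,u_0)$ are informative for stabilization with decay rate $\gamma$ if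 there exist $K\in\mathcal L(X,U)$ and $M\ge1$ with $\Sigma_{\mathrm{is}}\subseteq\Sigma_{K,M,\gamma}$. *)

(* Defs.v *)
From HB Require Import structures.
From mathcomp Require Import all_boot all_order all_algebra.
From mathcomp Require Import all_classical all_reals all_analysis.
From mathcomp Require Import complex.
From mathcomp Require Import ring lra.

Set Implicit Arguments.
Unset Strict Implicit.
Unset Printing Implicit Defensive.

Import Order.TTheory GRing.Theory Num.Theory.
Import numFieldNormedType.Exports.

Local Open Scope classical_set_scope.
Local Open Scope ring_scope.
Local Open Scope complex_scope.

(* The inner product is linear in its first argument.  The norm of a
   normedModType over R[i] takes its values in R[i] (as nonnegative reals). *)
HB.mixin Record isHilbert (R : realType) V & CompleteNormedModule R[i] V := {
  inner : V -> V -> R[i] ;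
  innerDl : forall x y z : V, inner (x + y) z = inner x z + inner y z ;
  innerZl : forall (a : R[i]) (x y : V), inner (a *: x) y = a * inner x y ;
  innerC : forall x y : V, inner y x = (inner x y)^*%R ;
  inner_norm : forall x : V, inner x x = `|x| ^+ 2
}.

#[short(type="hilbertType")]
HB.structure Definition Hilbert (R : realType) :=
  {V of isHilbert R V & CompleteNormedModule R[i] V}.

(* For linear maps between normed modules, bounded means continuous
   (linear_bounded_continuous). *)
HB.structure Definition BoundedOp (K : numDomainType) (X Y : normedModType K) :=
  {f of @GRing.Linear K X Y *:%R f & @isContinuous X Y f}.

Notation "{ 'bounded' X -> Y }" := (@BoundedOp.type _ X Y)
  (at level 0, X at level 98, Y at level 99,
   format "{ 'bounded'  X  ->  Y }") : type_scope.

Definition rnorm (R : realType) (V : normedZmodType R[i]) (x : V) : R :=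
  complex.Re `|x|.

Definition sqsummable (R : realType) : {pred nat -> R[i]} :=
  fun w => (\sum_(0 <= k <oo) (rnorm (w k) ^+ 2)%:E < +oo)%E.

Section Series.
Variable R : realType.
Local Notation C := R[i].
Local Notation Re := complex.Re.
Local Notation Im := complex.Im.
Implicit Types (u m : nat -> R) (v w : nat -> C).

Lemma rnorm_sq (z : C) : rnorm z ^+ 2 = Re z ^+ 2 + Im z ^+ 2.
Proof.
rewrite /rnorm normc_def /= sqr_sqrtr //.
by rewrite addr_ge0 // sqr_ge0.
Qed.

Lemma dom_is_cvg u m :
  (forall k, `|u k| <= m k) -> cvgn (series m) -> cvgn (series u).
Proof.
move=> um cm; apply: normed_cvg; apply: series_le_cvg cm => //= n.
exact: le_trans (um n).
Qed.

Lemma nneg_is_cvg u M : (forall k, 0 <= u k) ->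
  (forall n, \sum_(0 <= k < n) u k <= M) -> cvgn (series u).
Proof.
move=> u0 uM; apply: nondecreasing_is_cvgn.
  apply/nondecreasing_seqP => n; rewrite /series/= big_nat_recr //=.
  by rewrite lerDl.
by exists M => _ [n _ <-]; exact: uM.
Qed.

Lemma series_le_lim u : (forall k, 0 <= u k) -> cvgn (series u) ->
  forall n, \sum_(0 <= k < n) u k <= limn (series u).
Proof.
move=> u0 cu n; apply: (@nondecreasing_cvgn_le _ (series u)) => //.
apply/nondecreasing_seqP => k; rewrite /series/= big_nat_recr //=.
by rewrite lerDl.
Qed.

Lemma sqsummableP w :
  reflect (exists M : R, forall n, \sum_(0 <= k < n) rnorm (w k) ^+ 2 <= M)
    (w \in @sqsummable R).
Proof.
have p0 k : (0 <= (rnorm (w k) ^+ 2)%:E)%E by rewrite lee_fin sqr_ge0.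
apply: (iffP idP).
  rewrite /in_mem /= /sqsummable => wfin.
  have S0 : (0 <= \sum_(0 <= k <oo) (rnorm (w k) ^+ 2)%:E)%E.
    by apply: nneseries_ge0 => k _ _.
  exists (fine (\sum_(0 <= k <oo) (rnorm (w k) ^+ 2)%:E)%E) => n.
  rewrite -lee_fin fineK; last by rewrite ge0_fin_numE.
  by rewrite -sumEFin; apply: nneseries_lim_ge => k _ _.
move=> [M wM]; rewrite /in_mem /= /sqsummable.
apply: (@le_lt_trans _ _ M%:E); last exact: ltry.
apply: lime_le; first by apply: is_cvg_nneseries => k _ _.
by apply: nearW => n; rewrite sumEFin lee_fin.
Qed.

Lemma sqsummable_cvg w : w \in @sqsummable R ->
  cvgn (series (fun k => rnorm (w k) ^+ 2)).
Proof.
by move=> /sqsummableP[M wM]; apply: (nneg_is_cvg _ wM) => k; exact: sqr_ge0.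
Qed.

Lemma cvg_sqsummable w :
  cvgn (series (fun k => rnorm (w k) ^+ 2)) -> w \in @sqsummable R.
Proof.
move=> cw; apply/sqsummableP.
exists (limn (series (fun k => rnorm (w k) ^+ 2))).
by apply: series_le_lim => // k; exact: sqr_ge0.
Qed.

Lemma sqsummable_submod : submod_closed (@sqsummable R).
Proof.
split.
  apply/sqsummableP; exists 0 => n.
  by rewrite big1 // => k _; rewrite rnorm_sq /= expr0n addr0.
move=> a v w sv sw; apply: cvg_sqsummable.
have cv := sqsummable_cvg sv; have cw := sqsummable_cvg sw.
have cav := is_cvg_seriesZ (k := 2 * rnorm a ^+ 2) cv.
have c2w := is_cvg_seriesZ (k := 2) cw.
apply: dom_is_cvg (is_cvg_seriesD cav c2w) => k.
rewrite ger0_norm ?sqr_ge0 //.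
rewrite [leRHS](_ : _ = 2 * rnorm a ^+ 2 * rnorm (v k) ^+ 2
  + 2 * rnorm (w k) ^+ 2) // !rnorm_sq.
rewrite [(a *: v + w) k](_ : _ = a * v k + w k) //.
case: a (v k) (w k) {cav sv sw cv cw c2w} => a b [c d] [e f] /=.
have := sqr_ge0 (a * c - b * d - e); have := sqr_ge0 (a * d + b * c - f).
nra.
Qed.

HB.instance Definition _ := GRing.isSubmodClosed.Build C (nat -> C)
  (@sqsummable R) sqsummable_submod.

Lemma pairing_is_cvg v w : v \in @sqsummable R -> w \in @sqsummable R ->
  cvgn (series (fun k => Re (v k * (w k)^*))) /\
  cvgn (series (fun k => Im (v k * (w k)^*))).
Proof.
move=> sv sw; have cv := sqsummable_cvg sv; have cw := sqsummable_cvg sw.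
have c := is_cvg_seriesD cv cw.
have le1 (x y s t : R) : `|x * s + y * t| <= x ^+ 2 + y ^+ 2 + (s ^+ 2 + t ^+ 2).
  have := sqr_ge0 (x + s); have := sqr_ge0 (x - s).
  have := sqr_ge0 (y + t); have := sqr_ge0 (y - t).
  by rewrite ler_norml => ? ? ? ?; apply/andP; split; nra.
split; apply: dom_is_cvg c => k;
  rewrite [leRHS](_ : _ = rnorm (v k) ^+ 2 + rnorm (w k) ^+ 2) // !rnorm_sq;
  case: (v k) (w k) => a b [e f] /=.
  by have := le1 a b e f; rewrite (_ : a * e - b * - f = a * e + b * f) //; ring.
have := le1 a b (- f) e; rewrite sqrrN (addrC (f ^+ 2)).
by rewrite (_ : a * - f + b * e = a * - f + b * e) //; ring.
Qed.

End Series.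

(* Indices start at 0 instead of 1. *)
Record ell2 (R : realType) := Ell2 {
  ell2_seq :> nat -> R[i] ;
  ell2P : ell2_seq \in @sqsummable R }.

HB.instance Definition _ (R : realType) := [isSub for @ell2_seq R].
HB.instance Definition _ (R : realType) := [Choice of ell2 R by <:].
HB.instance Definition _ (R : realType) :=
  [SubChoice_isSubLmodule of ell2 R by <:].

Section Ell2.
Variable R : realType.
Local Notation C := R[i].
Local Notation Re := complex.Re.
Local Notation Im := complex.Im.
Implicit Types u v w : ell2 R.

Definition ell2_inner v w : C :=
  limn (series (fun k => Re (v k * (w k)^*))) +i*
  limn (series (fun k => Im (v k * (w k)^*))).

Definition ell2_norm w : C :=
  (Num.sqrt (limn (series (fun k => rnorm (w k) ^+ 2))))%:C.

Local Notation Q w := (limn (series (fun k => rnorm (w k) ^+ 2))).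

Lemma ell2_innerDl u v w :
  ell2_inner (u + v) w = ell2_inner u w + ell2_inner v w.
Proof.
have [cu1 cu2] := pairing_is_cvg (ell2P u) (ell2P w).
have [cv1 cv2] := pairing_is_cvg (ell2P v) (ell2P w).
rewrite /ell2_inner; apply/eqP; rewrite eq_complex /=; apply/andP; split.
  rewrite -lim_seriesD //; apply/eqP; congr (limn (series _)); apply/funext => k.
  rewrite [RHS](_ : _ = Re (u k * (w k)^*) + Re (v k * (w k)^*)) //.
  rewrite [LHS](_ : _ = Re ((u k + v k) * (w k)^*)) //.
  by case: (u k) (v k) (w k) => ? ? [? ?] [? ?] /=; ring.
rewrite -lim_seriesD //; apply/eqP; congr (limn (series _)); apply/funext => k.
rewrite [RHS](_ : _ = Im (u k * (w k)^*) + Im (v k * (w k)^*)) //.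
rewrite [LHS](_ : _ = Im ((u k + v k) * (w k)^*)) //.
by case: (u k) (v k) (w k) => ? ? [? ?] [? ?] /=; ring.
Qed.

Lemma ell2_innerZl (a : C) v w : ell2_inner (a *: v) w = a * ell2_inner v w.
Proof.
have [c1 c2] := pairing_is_cvg (ell2P v) (ell2P w).
have cZ1 (r : R) := is_cvg_seriesZ (k := r) c1.
have cZ2 (r : R) := is_cvg_seriesZ (k := r) c2.
have L1 (r : R) : r * limn (series (fun k => Re (v k * (w k)^*))) = limn (series _)
  := esym (lim_seriesZ r c1).
have L2 (r : R) : r * limn (series (fun k => Im (v k * (w k)^*))) = limn (series _)
  := esym (lim_seriesZ r c2).
have E k : (a *: v) k * (w k)^* = a * (v k * (w k)^*) by rewrite mulrA.
case: a E => a b E.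
rewrite /ell2_inner; apply/eqP; rewrite eq_complex /=; apply/andP; split.
  rewrite L1 L2 -lim_seriesB //; apply/eqP.
  congr (limn (series _)); apply/funext => k.
  transitivity (Re ((a +i* b) * (v k * (w k)^*))); first by rewrite -E.
  rewrite [RHS](_ : _ = a * Re (v k * (w k)^*) - b * Im (v k * (w k)^*)) //.
  by case: (v k * _).
rewrite L1 L2 -lim_seriesD //; apply/eqP.
congr (limn (series _)); apply/funext => k.
transitivity (Im ((a +i* b) * (v k * (w k)^*))); first by rewrite -E.
rewrite [RHS](_ : _ = a * Im (v k * (w k)^*) + b * Re (v k * (w k)^*)) //.
by case: (v k * _).
Qed.

Lemma ell2_innerC v w : ell2_inner w v = (ell2_inner v w)^*%R.
Proof.
have [_ c2] := pairing_is_cvg (ell2P v) (ell2P w).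
rewrite /ell2_inner; apply/eqP; rewrite eq_complex /=; apply/andP; split.
  apply/eqP; congr (limn (series _)); apply/funext => k.
  by case: (v k) (w k) => a b [e f] /=; ring.
rewrite -lim_seriesN //; apply/eqP; congr (limn (series _)); apply/funext => k.
rewrite [RHS](_ : _ = - Im (v k * (w k)^*)) //.
by case: (v k) (w k) => a b [e f] /=; ring.
Qed.

Lemma ell2_innerE w : ell2_inner w w = (Q w)%:C.
Proof.
rewrite /ell2_inner; apply/eqP; rewrite eq_complex /=; apply/andP; split.
  apply/eqP; congr (limn (series _)); apply/funext => k; rewrite rnorm_sq.
  by case: (w k) => a b /=; ring.
rewrite (_ : (fun k => _) = fun=> 0).
  rewrite (_ : series _ = fun=> 0) ?lim_cst //.
  by apply/funext => n; rewrite /series /= big1.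
by apply/funext => k; case: (w k) => a b /=; ring.
Qed.

Lemma ell2_partial_le w n : \sum_(0 <= k < n) rnorm (w k) ^+ 2 <= Q w.
Proof.
apply: series_le_lim; first by move=> k; exact: sqr_ge0.
exact: sqsummable_cvg (ell2P w).
Qed.

Lemma ell2_coord_le w k : rnorm (w k) ^+ 2 <= Q w.
Proof.
apply: le_trans (ell2_partial_le w k.+1).
by rewrite big_nat_recr //= lerDr sumr_ge0 // => i _; exact: sqr_ge0.
Qed.

Lemma ell2_Q_ge0 w : 0 <= Q w.
Proof. by apply: le_trans (ell2_coord_le w 0); exact: sqr_ge0. Qed.

Lemma ell2_norm_eq0 w : ell2_norm w = 0 -> w = 0.
Proof.
move=> /complexI /eqP; rewrite sqrtr_eq0 => w0.
apply/val_inj/funext => k /=; have := le_trans (ell2_coord_le w k) w0.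
rewrite rnorm_sq => h.
have := sqr_ge0 (Re (w k)); have := sqr_ge0 (Im (w k)) => b0 a0.
have /eqP : Re (w k) ^+ 2 = 0 by lra.
have /eqP : Im (w k) ^+ 2 = 0 by lra.
rewrite !sqrf_eq0; case: (w k) => a b /= /eqP -> /eqP ->.
by [].
Qed.

Lemma ell2_QD v w (a b : R) :
  Q (a%:C *: v + b%:C *: w) =
  a ^+ 2 * Q v + b ^+ 2 * Q w + a * b * (2 * Re (ell2_inner v w)).
Proof.
apply: complexI; rewrite -ell2_innerE ell2_innerDl !ell2_innerZl.
rewrite !(ell2_innerC (_ + _)) !ell2_innerDl !ell2_innerZl !ell2_innerE.
rewrite (ell2_innerC v w).
case: (ell2_inner v w) => c d; apply/eqP; rewrite eq_complex /=.
by apply/andP; split; apply/eqP; ring.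
Qed.

Lemma ell2_CS v w : Re (ell2_inner v w) <= Num.sqrt (Q v) * Num.sqrt (Q w).
Proof.
set r := Re _; set q := Q w.
have q0 : 0 <= q := ell2_Q_ge0 w.
have p0 : 0 <= Q v := ell2_Q_ge0 v.
rewrite -sqrtrM //; apply: (le_trans (ler_norm _)); rewrite -sqrtr_sqr.
rewrite ler_sqrt ?mulr_ge0 //.
have := ell2_Q_ge0 (q%:C *: v + (- r)%:C *: w).
rewrite ell2_QD -/r -/q => h.
have := q0; rewrite le_eqVlt => /orP[/eqP q00|qgt0]; last first.
  have : 0 <= q * (Q v * q - r ^+ 2).
    by rewrite [leRHS](_ : _ = q ^+ 2 * Q v + (- r) ^+ 2 * q + q * - r * (2 * r)) //; ring.
  by rewrite pmulr_rge0 // subr_ge0.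
have w0 : w = 0.
  by apply: ell2_norm_eq0; rewrite /ell2_norm -/q -q00 sqrtr0.
rewrite /r w0 ell2_innerC -(scale0r (0 : ell2 R)) ell2_innerZl mul0r /=.
by rewrite expr0n /= mulr_ge0.
Qed.

Lemma ell2_normD v w : ell2_norm (v + w) <= ell2_norm v + ell2_norm w.
Proof.
rewrite /ell2_norm -rmorphD lecR.
have p0 := ell2_Q_ge0 v; have q0 := ell2_Q_ge0 w.
rewrite -[leRHS]ger0_norm ?addr_ge0 ?sqrtr_ge0 // -sqrtr_sqr.
rewrite ler_sqrt ?sqr_ge0 // sqrrD !sqr_sqrtr //.
have := ell2_QD v w 1 1; rewrite !scale1r => ->.
have := ell2_CS v w; set s := Num.sqrt _ * _ => h.
lra.
Qed.

Lemma ell2_normZ (a : C) w : ell2_norm (a *: w) = `|a| * ell2_norm w.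
Proof.
rewrite /ell2_norm; have -> : Q (a *: w) = rnorm a ^+ 2 * Q w.
  apply: complexI; rewrite -ell2_innerE ell2_innerZl ell2_innerC ell2_innerZl.
  rewrite ell2_innerE rnorm_sq; case: a => a b.
  by apply/eqP; rewrite eq_complex /=; apply/andP; split; apply/eqP; ring.
rewrite sqrtrM ?sqr_ge0 // sqrtr_sqr rmorphM; congr (_ * _).
by rewrite /rnorm normc_def /= ger0_norm // sqrtr_ge0.
Qed.

HB.instance Definition _ :=
  Lmodule_isNormed.Build C (ell2 R) ell2_normD ell2_normZ ell2_norm_eq0.

Lemma ell2_inner_norm w : ell2_inner w w = `|w| ^+ 2.
Proof.
rewrite ell2_innerE -[RHS]/(ell2_norm w ^+ 2) /ell2_norm -rmorphXn /=.
by rewrite sqr_sqrtr // ell2_Q_ge0.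
Qed.

Lemma ell2_ballP (a w : ell2 R) (e : R) : 0 < e ->
  ball a e%:C w <-> Q (a - w) < e ^+ 2.
Proof.
move=> e0; rewrite -ball_normE /=.
rewrite -[`|_|]/(ell2_norm (a - w)) /ell2_norm ltcR.
by rewrite -{1}(gtr0_norm e0) -sqrtr_sqr ltr_sqrt // exprn_gt0.
Qed.

Lemma cvg_sqdist (T : Type) (F : set_system T) (f : T -> R) (a l : R) :
  Filter F -> f @ F --> l ->
  (fun t => (a - f t) * (a - f t)) @ F --> (a - l) * (a - l).
Proof.
move=> FF fl; have h : (fun t => a - f t) @ F --> a - l.
  by apply: cvgB fl; exact: cvg_cst.
exact: (cvgM h h).
Qed.

Lemma ell2_complete (F : set_system (ell2 R)) :
  ProperFilter F -> cauchy F -> cvg F.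
Proof.
move=> FF /cauchyP Fc.
have {}Fc (e : R) : 0 < e -> exists a : ell2 R, F [set w : ell2 R | Q (a - w) < e ^+ 2].
  move=> e0; have /Fc[a Fa] : 0 < e%:C :> C by rewrite ltcR.
  by exists a; apply: filterS Fa => w /ell2_ballP; exact.
have coordB (a w : ell2 R) k : (a - w) k = a k - w k by [].
have cRe k : cvg ((fun w : ell2 R => Re (w k)) @ F).
  apply/cauchy_cvgP/cauchyP => e e0; have [a Fa] := Fc e e0.
  exists (Re (a k)); change (F [set w : ell2 R | `|Re (a k) - Re (w k)| < e]).
  apply: filterS Fa => w aw.
  have {}aw : Q (a - w) < e ^+ 2 := aw.
  change (`|Re (a k) - Re (w k)| < e).
  rewrite -(@ltr_pXn2r _ 2) ?nnegrE ?(ltW e0) // real_normK ?num_real //.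
  apply: le_lt_trans aw; apply: le_trans (ell2_coord_le (a - w) k).
  rewrite rnorm_sq coordB; case: (a k) (w k) => x y [z t] /=.
  by rewrite lerDl sqr_ge0.
have cIm k : cvg ((fun w : ell2 R => Im (w k)) @ F).
  apply/cauchy_cvgP/cauchyP => e e0; have [a Fa] := Fc e e0.
  exists (Im (a k)); change (F [set w : ell2 R | `|Im (a k) - Im (w k)| < e]).
  apply: filterS Fa => w aw.
  have {}aw : Q (a - w) < e ^+ 2 := aw.
  change (`|Im (a k) - Im (w k)| < e).
  rewrite -(@ltr_pXn2r _ 2) ?nnegrE ?(ltW e0) // real_normK ?num_real //.
  apply: le_lt_trans aw; apply: le_trans (ell2_coord_le (a - w) k).
  rewrite rnorm_sq coordB; case: (a k) (w k) => x y [z t] /=.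
  by rewrite lerDr sqr_ge0.
pose l k : C := lim ((fun w : ell2 R => Re (w k)) @ F) +i*
                lim ((fun w : ell2 R => Im (w k)) @ F).
have part (e : R) (a : ell2 R) : F [set w : ell2 R | Q (a - w) < e ^+ 2] ->
    forall n, \sum_(0 <= k < n) rnorm (a k - l k) ^+ 2 <= e ^+ 2.
  move=> Fa n.
  pose f (w : ell2 R) : R := \sum_(0 <= k < n) rnorm (a k - w k) ^+ 2.
  have cf : f @ F --> \sum_(0 <= k < n) rnorm (a k - l k) ^+ 2.
    rewrite /f {f}; elim: n => [|n IHn].
      rewrite big_nil (_ : (fun w => _) = fun=> 0); first exact: cvg_cst.
      by apply/funext => w; rewrite big_nil.
    rewrite big_nat_recr //= (_ : (fun w : ell2 R => _) = fun w : ell2 R =>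
      \sum_(0 <= k < n) rnorm (a k - w k) ^+ 2 + rnorm (a n - w n) ^+ 2); last first.
      by apply/funext => w; rewrite big_nat_recr.
    apply: cvgD => //; move: n {IHn} => k.
    rewrite rnorm_sq (_ : (fun w : ell2 R => _) = fun w : ell2 R =>
      (Re (a k) - Re (w k)) * (Re (a k) - Re (w k)) +
      (Im (a k) - Im (w k)) * (Im (a k) - Im (w k))); last first.
      apply/funext => w; rewrite rnorm_sq.
      by case: (a k) (w k) => x y [z t].
    have -> : Re (a k - l k) = Re (a k) - lim ((fun w : ell2 R => Re (w k)) @ F).
      by rewrite /l; case: (a k).
    have -> : Im (a k - l k) = Im (a k) - lim ((fun w : ell2 R => Im (w k)) @ F).
      by rewrite /l; case: (a k).
    rewrite !expr2; apply: cvgD.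
      exact: (cvg_sqdist (f := fun w : ell2 R => Re (w k))) (cRe k).
    exact: (cvg_sqdist (f := fun w : ell2 R => Im (w k))) (cIm k).
  apply: (@ler_cvg_to _ F _ R f (fun=> e ^+ 2)) => //; first exact: cvg_cst.
  apply: filterS Fa => w aw.
  have {}aw : Q (a - w) < e ^+ 2 := aw.
  apply: le_trans (ltW aw).
  exact: (ell2_partial_le (a - w)).
have sl : l \in @sqsummable R.
  have [a Fa] := Fc 1 ltr01.
  have sal : (fun k => a k - l k) \in @sqsummable R.
    by apply/sqsummableP; exists (1 ^+ 2) => n; exact: part.
  rewrite (_ : l = (a : nat -> C) - (fun k => a k - l k)).
    by rewrite rpredB // ell2P.
  by apply/funext => k; rewrite [RHS](_ : _ = a k - (a k - l k)) // subKr.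
pose L := Ell2 sl.
apply/cvg_ex; exists L => /=; apply/cvgrPdist_lt => /= eps eps0.
have [e e0 ee] : exists2 e : R, 0 < e & eps = e%:C.
  case: eps eps0 => x y; rewrite ltcE /= => /andP[/eqP -> x0].
  by exists x.
rewrite ee.
have e3 : 0 < e / 3 by rewrite divr_gt0.
have [a Fa] := Fc _ e3.
have aL : Q (a - L) <= (e / 3) ^+ 2.
  apply: limr_le; first exact: sqsummable_cvg (ell2P (a - L)).
  by apply: nearW => n; exact: part.
apply: filterS Fa => w aw.
  have {}aw : Q (a - w) < (e / 3) ^+ 2 := aw.
have h1 : `|a - L| <= (e / 3)%:C.
  rewrite -[`|_|]/(ell2_norm (a - L)) /ell2_norm lecR.
  by rewrite -(gtr0_norm e3) -sqrtr_sqr ler_sqrt // sqr_ge0.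
have h2 : `|a - w| < (e / 3)%:C.
  by move/ell2_ballP: aw => /(_ e3); rewrite -ball_normE.
have -> : L - w = (a - w) - (a - L) by rewrite opprB [RHS]addrC addrA subrK.
apply: (le_lt_trans (ler_normB _ _)).
apply: (@lt_le_trans _ _ ((e / 3)%:C + (e / 3)%:C)); first exact: ltr_leD.
by rewrite -rmorphD lecR; lra.
Qed.

HB.instance Definition _ := Uniform_isComplete.Build (ell2 R) ell2_complete.

HB.instance Definition _ := isHilbert.Build R (ell2 R)
  ell2_innerDl ell2_innerZl ell2_innerC ell2_inner_norm.

End Ell2.

Section Operators.
Variable R : realType.
Implicit Types X Y Z U : hilbertType R.

Definition nontrivial X : Prop := exists x : X, x != 0.

Definition finite_dim X : Prop :=
  exists (n : nat) (e : 'I_n -> X), forall x : X,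
    exists a : 'I_n -> R[i], x = \sum_(i < n) a i *: e i.

(* Only meaningful for bounded f; it is applied below to sums, compositions and
   iterates of bounded operators. *)
Definition opnorm X Y (f : X -> Y) : R :=
  sup [set rnorm (f x) | x in [set x : X | rnorm x <= 1]].

(* The vector v is unique, and exists by the Riesz representation theorem. *)
Definition adjoint Y Z (T : {bounded Y -> Z}) (z : Z) : Y :=
  xget 0 [set v | forall y, inner (T y) z = inner y v].

(* In R[i], 0 <= z means that z is real and nonnegative. *)
Definition psd Y (T : Y -> Y) : Prop := forall y, 0 <= inner (T y) y.

Definition op_le Y (S T : Y -> Y) : Prop := psd (fun y => T y - S y).

Definition power_stable X (gamma : R) (F : X -> X) : Prop :=
  exists2 M : R, 1 <= M & forall k, opnorm (iter k F) <= M * gamma ^+ k.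

Definition bessel Y (eta : nat -> Y) : Prop :=
  exists2 alpha : R, 0 < alpha & forall y : Y,
    (\sum_(0 <= k <oo) (rnorm (inner y (eta k)) ^+ 2)%:E
       <= (alpha * rnorm y ^+ 2)%:E)%E.

Definition frame Y (eta : nat -> Y) : Prop :=
  exists alpha beta : R, [/\ 0 < alpha, 0 < beta & forall y : Y,
    ((beta * rnorm y ^+ 2)%:E
       <= \sum_(0 <= k <oo) (rnorm (inner y (eta k)) ^+ 2)%:E
       <= (alpha * rnorm y ^+ 2)%:E)%E].

Definition synthesis_operator Y (eta : nat -> Y) (T : {bounded ell2 R -> Y}) :
    Prop :=
  forall w : ell2 R, series (fun k => w k *: eta k) @ \oo --> T w.

Definition Sigma_is X U (x1 x0 : nat -> X) (u0 : nat -> U) :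
    set ({bounded X -> X} * {bounded U -> X}) :=
  [set AB : {bounded X -> X} * {bounded U -> X} | forall k, x1 k = AB.1 (x0 k) + AB.2 (u0 k)].

Definition Sigma_stab X U (K : {bounded X -> U}) (M gamma : R) :
    set ({bounded X -> X} * {bounded U -> X}) :=
  [set AB : {bounded X -> X} * {bounded U -> X} | forall k,
     opnorm (iter k (fun x => AB.1 x + AB.2 (K x))) <= M * gamma ^+ k].

Definition informative X U (x1 x0 : nat -> X) (u0 : nat -> U) (gamma : R) :
    Prop :=
  exists (K : {bounded X -> U}) (M : R),
    1 <= M /\ Sigma_is x1 x0 u0 `<=` Sigma_stab K M gamma.

End Operators.

(* Main.v *)
(** From (ii), the feedback [K = Ups0 Xi0d] closes every data-compatible pair
    [(A, B)] to the same operator [A + B K = (A Xi0 + B Ups0) Xi0d = Xi1 Xi0d], and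
    the lower frame bound says that [Xi0^*] is bounded below.

    From (i), if [A0 x0(k) + B0 u0(k) = 0] for all [k], then [A + t A0 + (B + t B0) K]
    is bounded uniformly in [t], so [A0 + B0 K = 0].  Applied to rank-one
    operators [A0], this makes [Xi0^*] injective; together with the inequality
    [|Xi0 w| <= c |Xi0^* Xi0 w|] it yields a bounded right inverse [D] of [Xi0].
    Applied to rank-one pairs, it shows that [K - Ups0 D] takes values in the
    finite-dimensional space [Ups0 (ker Xi0)], so [D] can be corrected inside
    [ker Xi0] to a right inverse with [Ups0 Xi0d = K]; then
    [Xi1 Xi0d = As + Bs K]. *)

Require Import Defs.
From HB Require Import structures.
From mathcomp Require Import all_boot all_order all_algebra.
From mathcomp Require Import all_classical all_reals all_analysis.
From mathcomp Require Import complex.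
From mathcomp Require Import ring lra.

Set Implicit Arguments.
Unset Strict Implicit.
Unset Printing Implicit Defensive.

Import Order.TTheory GRing.Theory Num.Theory.
Import numFieldNormedType.Exports.

Local Open Scope classical_set_scope.
Local Open Scope ring_scope.
Local Open Scope complex_scope.

(** * Real-valued norms, geometric convergence and inner products *)

Section RealNorm.
Variable R : realType.
Local Notation C := R[i].

Lemma posC_real (e : C) : 0 < e -> exists2 r : R, 0 < r & e = r%:C.
Proof.
by case: e => a b; rewrite ltcE /= => /andP[/eqP -> a0]; exists a.
Qed.

Section NormedZmod.
Variable V : normedZmodType C.
Implicit Types x y : V.

Lemma rnormE x : `|x| = (rnorm x)%:C.
Proof. by rewrite /rnorm RRe_real // normr_real. Qed.

Lemma rnorm_ge0 x : 0 <= rnorm x.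
Proof. by rewrite -lecR -rnormE; exact: normr_ge0. Qed.

Lemma rnorm0 : rnorm (0 : V) = 0.
Proof. by rewrite /rnorm normr0. Qed.

Lemma rnorm_eq0 x : (rnorm x == 0) = (x == 0).
Proof. by rewrite -[RHS]normr_eq0 rnormE -(inj_eq (@complexI R)). Qed.

Lemma rnormN x : rnorm (- x) = rnorm x.
Proof. by rewrite /rnorm normrN. Qed.

Lemma rnormB x y : rnorm (x - y) = rnorm (y - x).
Proof. by rewrite -rnormN opprB. Qed.

Lemma ler_rnormD x y : rnorm (x + y) <= rnorm x + rnorm y.
Proof. by rewrite -lecR rmorphD /= -!rnormE; exact: ler_normD. Qed.

Lemma ler_rnorm_sum n (f : 'I_n -> V) :
  rnorm (\sum_i f i) <= \sum_i rnorm (f i).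
Proof.
elim/big_ind2: _ => [|x a y b xa yb|//]; first by rewrite rnorm0.
exact: le_trans (ler_rnormD _ _) (lerD xa yb).
Qed.

End NormedZmod.

Lemma rnormC (a : R) : 0 <= a -> rnorm (a%:C : C) = a.
Proof. by move=> a0; apply: complexI; rewrite -rnormE ger0_norm // lecR. Qed.

Lemma mulr_conj (a : C) : a * (a^*)%R = (rnorm a ^+ 2)%:C.
Proof. by rewrite -normCK rnormE rmorphXn /=. Qed.

Section NormedMod.
Variable V : normedModType C.

Lemma rnormZ (a : C) (x : V) : rnorm (a *: x) = rnorm a * rnorm x.
Proof. by apply: complexI; rewrite rmorphM /= -!rnormE normrZ. Qed.

Lemma cvg_rnormP (y : nat -> V) (l : V) :
  y @ \oo --> l <->
  (forall e : R, 0 < e -> \forall n \near \oo, rnorm (l - y n) < e).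
Proof.
split.
  move=> /cvgrPdist_lt yl e e0; have := yl e%:C; rewrite ltcR => /(_ e0).
  by apply: filterS => n; rewrite rnormE ltcR.
move=> yl; apply/cvgrPdist_lt => _ /posC_real[e e0 ->].
by have := yl e e0; apply: filterS => n; rewrite rnormE ltcR.
Qed.

Lemma cvg_rnorm_le (y : nat -> V) (l v : V) (b : R) :
  y @ \oo --> l -> (\forall n \near \oo, rnorm (v - y n) <= b) ->
  rnorm (v - l) <= b.
Proof.
move=> /cvg_rnormP yl yb; apply/ler_addgt0Pr => e e0.
have := filterI (yl e e0) yb => -[n _ /(_ n (leqnn n))[h1 h2]].
have -> : v - l = (v - y n) - (l - y n) by rewrite opprB addrA subrK.
by rewrite (le_trans (ler_rnormD _ _)) // rnormN lerD // ltW.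
Qed.

End NormedMod.

Lemma near_geometric_lt (a r : R) : 0 <= r < 1 -> forall e, 0 < e ->
  \forall n \near \oo, a * r ^+ n < e.
Proof.
move=> /andP[r0 r1] e e0.
have := @cvg_geometric R a r; rewrite ger0_norm // => /(_ r1)/cvgrPdist_lt/(_ e e0).
by apply: filterS => n; rewrite sub0r normrN; apply: le_lt_trans; exact: ler_norm.
Qed.

(** Summing the tail of the increments as a geometric series shows that [y] is Cauchy, and the same
    estimate survives in the limit. *)
Lemma geometric_increments_cvg (V : completeNormedModType C) (y : nat -> V)
    (c r : R) : 0 <= r < 1 -> (forall n, rnorm (y n.+1 - y n) <= c * r ^+ n) ->
  exists2 l : V, y @ \oo --> l &
    forall n, rnorm (l - y n) <= c / (1 - r) * r ^+ n.
Proof.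
move=> r01 yc; have /andP[r0 r1] := r01.
have r1' : 0 < 1 - r by rewrite subr_gt0.
have c0 : 0 <= c by have := yc 0%N; rewrite expr0 mulr1; apply: le_trans; exact: rnorm_ge0.
(* The exact finite geometric sum is kept, since the bound [c / (1 - r) * r ^+ n] alone would not
   carry an induction on [m]. *)
have yd n m : rnorm (y (n + m)%N - y n) <= c / (1 - r) * (r ^+ n - r ^+ (n + m)).
  elim: m => [|m IH]; first by rewrite addn0 !subrr rnorm0 mulr0.
  rewrite addnS (_ : y _ - y n = y (n + m).+1 - y (n + m)%N + (y (n + m)%N - y n));
    last by rewrite addrA subrK.
  apply: le_trans (ler_rnormD _ _) _; apply: le_trans (lerD (yc _) IH) _.
  rewrite exprS le_eqVlt; apply/orP; left; apply/eqP; field; lra.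
have yd' n m : (n <= m)%N -> rnorm (y m - y n) <= c / (1 - r) * r ^+ n.
  move=> /subnKC <-; apply: le_trans (yd _ _) _.
  have cr0 : 0 <= c / (1 - r) by rewrite divr_ge0 // ltW.
  by apply: (ler_wpM2l cr0); rewrite gerBl exprn_ge0.
have /cvg_ex[l yl] : cvgn y.
  apply/cauchy_cvgP/cauchyP => _ /posC_real[e e0 ->].
  have [n _ /(_ n (leqnn n)) ne] := near_geometric_lt (c / (1 - r)) r01 e0.
  exists (y n); exists n => // m /= nm; rewrite -ball_normE /=.
  by rewrite rnormE ltcR rnormB; apply: le_lt_trans (yd' _ _ nm) ne.
exists l => // n; rewrite rnormB; apply: cvg_rnorm_le yl _.
by exists n => // m /= nm; rewrite rnormB yd'.
Qed.

Section InnerProduct.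
Variable X : hilbertType R.
Implicit Types x y z : X.

Lemma innerDr x y z : inner x (y + z) = inner x y + inner x z.
Proof. by rewrite innerC innerDl rmorphD /= -!innerC. Qed.

Lemma innerZr a x y : inner x (a *: y) = (a^*)%R * inner x y.
Proof. by rewrite innerC innerZl rmorphM /= -innerC. Qed.

Lemma inner0l y : inner 0 y = 0.
Proof. by rewrite -(scale0r y) innerZl mul0r. Qed.

Lemma inner0r x : inner x 0 = 0.
Proof. by rewrite innerC inner0l conjC0. Qed.

Lemma innerNl x y : inner (- x) y = - inner x y.
Proof. by rewrite -scaleN1r innerZl mulN1r. Qed.

Lemma innerNr x y : inner x (- y) = - inner x y.
Proof. by rewrite innerC innerNl rmorphN /= -innerC. Qed.

Lemma inner_suml n (f : 'I_n -> X) y :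
  inner (\sum_i f i) y = \sum_i inner (f i) y.
Proof.
elim/big_ind2: _ => [|? ? ? ? <- <-|//]; first exact: inner0l.
by rewrite innerDl.
Qed.

Lemma inner_rnorm x : inner x x = (rnorm x ^+ 2)%:C.
Proof. by rewrite inner_norm rnormE rmorphXn /=. Qed.

Lemma inner_eq0 x : (inner x x == 0) = (x == 0).
Proof. by rewrite inner_norm expf_eq0 normr_eq0. Qed.

Lemma rnormB_sq x y :
  rnorm (x - y) ^+ 2 = rnorm x ^+ 2 - 2 * complex.Re (inner x y) + rnorm y ^+ 2.
Proof.
apply: complexI; rewrite -inner_rnorm !(innerDl, innerDr, innerNl, innerNr).
rewrite !inner_rnorm (innerC x y); case: (inner x y) => a b.
by apply/eqP; rewrite eq_complex /=; apply/andP; split; apply/eqP; ring.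
Qed.

(** The square of the norm of [|y|^2 x - <x,y> y] expands to [|y|^2 (|x|^2 |y|^2 - |<x,y>|^2)]. *)
Lemma Cauchy_Schwarz x y : rnorm (inner x y) <= rnorm x * rnorm y.
Proof.
have [->|y0] := eqVneq y 0; first by rewrite inner0r !rnorm0 mulr0.
have yp : 0 < rnorm y by rewrite lt_neqAle rnorm_ge0 andbT eq_sym rnorm_eq0.
set a := inner x y; set n := rnorm y.
have : 0 <= rnorm ((n ^+ 2)%:C *: x - a *: y) ^+ 2 by exact: sqr_ge0.
rewrite rnormB_sq !rnormZ innerZl innerZr -/a (mulrC (a^*)%R) mulr_conj.
rewrite -rmorphM /= rnormC ?sqr_ge0 // -/n => h.
have {}h : 0 <= n ^+ 2 * (n ^+ 2 * rnorm x ^+ 2 - rnorm a ^+ 2).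
  by apply: le_trans h _; rewrite le_eqVlt; apply/orP; left; apply/eqP; ring.
rewrite -(@ler_pXn2r _ 2) ?nnegrE ?mulr_ge0 ?rnorm_ge0 // exprMn mulrC.
by move: h; rewrite pmulr_rge0 ?exprn_gt0 // subr_ge0.
Qed.

End InnerProduct.

End RealNorm.

(** * Bounded operators and pointwise norm bounds *)

Section BoundedOperators.
Variable R : realType.
Local Notation C := R[i].

Section Normed.
Variables X Y : normedModType C.

Lemma bounded_rnorm (F : {bounded X -> Y}) :
  exists2 b : R, 0 < b & forall x, rnorm (F x) <= b * rnorm x.
Proof.
have cF : continuous F by exact: cts_fun.
have /linear_boundedP[m [mr mP]] := continuous_linear_bounded 0 (cF 0).
(* [mP] applies only to constants strictly above [m]; adding 1 to the maximum gives this and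
   positivity. *)
exists (Num.max (complex.Re m) 0 + 1).
  by rewrite ltr_wpDl // le_max lexx orbT.
move=> x; rewrite -lecR rmorphM /= -!rnormE; apply: mP.
rewrite -(RRe_real mr) ltcR; apply: (@le_lt_trans _ _ (Num.max (complex.Re m) 0)).
  by rewrite le_max lexx.
by rewrite ltrDl.
Qed.

Lemma bounded_of_rnorm (f : X -> Y) (b : R) : linear f ->
  (forall x, rnorm (f x) <= b * rnorm x) -> {F : {bounded X -> Y} | F =1 f}.
Proof.
move=> lf bf.
pose fL := GRing.isLinear.Build C X Y *:%R f lf.
pose f0 : {linear X -> Y} := HB.pack f fL.
have cf : continuous f.
  apply: (@bounded_linear_continuous _ _ _ f0); apply/linear_boundedP.
  exists b%:C; split; first by rewrite complex_real.
  move=> r br x; rewrite rnormE (le_trans (y := (b * rnorm x)%:C)) ?lecR //.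
  rewrite rnormE rmorphM /= ler_wpM2r ?lecR ?rnorm_ge0 //; exact: ltW.
pose fC := isContinuous.Build X Y f cf.
pose F : {bounded X -> Y} := HB.pack f fL fC.
by exists F.
Qed.

Lemma bounded_cvg (F : {bounded X -> Y}) (y : nat -> X) (l : X) :
  y @ \oo --> l -> (F \o y) @ \oo --> F l.
Proof. by move=> yl; apply: continuous_cvg => //; exact: cts_fun. Qed.

Lemma norm_cvg_unique (y : nat -> X) (a b : X) :
  y @ \oo --> a -> y @ \oo --> b -> a = b.
Proof. by move=> ya yb; exact: (cvg_unique (@norm_hausdorff _ X) ya yb). Qed.

End Normed.

Lemma le_opnorm (X Y : hilbertType R) (f : X -> Y) (b : R) (x : X) :
  (forall x, rnorm (f x) <= b * rnorm x) -> rnorm x <= 1 ->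
  rnorm (f x) <= opnorm f.
Proof.
move=> bf x1; apply: ub_le_sup; last by exists x.
(* The sign of [b] is unknown, and only a nonnegative constant is monotone in [rnorm z <= 1]. *)
exists (Num.max b 0) => _ [z /= z1 <-].
apply: le_trans (bf z) _; rewrite -[leRHS]mulr1.
apply: (@le_trans _ _ (Num.max b 0 * rnorm z)).
  by rewrite ler_wpM2r ?rnorm_ge0 // le_max lexx.
by rewrite ler_wpM2l // le_max lexx orbT.
Qed.

End BoundedOperators.

Lemma inner_inj (R : realType) (Z : hilbertType R) (a b : Z) :
  (forall z, inner z a = inner z b) -> a = b.
Proof.
move=> h; apply/eqP; rewrite -subr_eq0 -inner_eq0 innerDr innerNr.
by rewrite h subrr.
Qed.

(** * Bounded right inverses from a lower bound on the adjoint *)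

Section RightInverse.
Variables (R : realType) (X Y : hilbertType R).
Implicit Types (T : {bounded Y -> X}) (Ta : X -> Y).

(** A relation rather than the chosen [adjoint T]: an explicit adjoint can then be supplied without
    the Riesz theorem. *)
Definition adjoint_pair T Ta := forall y x, inner (T y) x = inner y (Ta x).

Lemma adjoint_linear T Ta : adjoint_pair T Ta -> linear Ta.
Proof.
move=> TaE a x y; apply: inner_inj => z.
by rewrite -TaE !(innerDr, innerZr) -!TaE.
Qed.

(** Divide [|Ta x|^2 = <T (Ta x), x> <= b |Ta x| |x|] by [|Ta x|]. *)
Lemma adjoint_rnorm T Ta (b : R) : adjoint_pair T Ta -> 0 <= b ->
  (forall y, rnorm (T y) <= b * rnorm y) ->
  forall x, rnorm (Ta x) <= b * rnorm x.
Proof.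
move=> TaE b0 Tb x; have [->|Tx0] := eqVneq (Ta x) 0.
  by rewrite rnorm0 mulr_ge0 ?rnorm_ge0.
have Tp : 0 < rnorm (Ta x) by rewrite lt_neqAle rnorm_ge0 andbT eq_sym rnorm_eq0.
rewrite -(ler_pM2l Tp) mulrA (mulrC _ b) -expr2.
have -> : rnorm (Ta x) ^+ 2 = rnorm (inner (T (Ta x)) x).
  by rewrite TaE inner_rnorm rnormC // sqr_ge0.
apply: le_trans (Cauchy_Schwarz _ _) _.
by rewrite ler_wpM2r ?rnorm_ge0.
Qed.

(* The gradient iteration [y - t T Ta y] contracts geometrically on the range of
   [T], so its orbits converge to a zero of [T Ta], hence to 0; summing an orbit
   solves [T Ta x = y]. *)
Lemma right_inverse_of_lower_bound T Ta (c : R) : adjoint_pair T Ta ->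
  (forall x, Ta x = 0 -> x = 0) ->
  (forall y, rnorm (T y) <= c * rnorm (Ta (T y))) ->
  exists D : {bounded X -> Y}, cancel D T.
Proof.
move=> TaE Ta_inj Tc.
have [b b0 Tb] := bounded_rnorm T.
have Tab := adjoint_rnorm TaE (ltW b0) Tb.
have Tal := adjoint_linear TaE.
have Sl : linear (T \o Ta) by move=> a x y /=; rewrite Tal linearP.
have Sb x : rnorm ((T \o Ta) x) <= b * b * rnorm x.
  by apply: le_trans (Tb _) _; rewrite -mulrA ler_wpM2l ?(ltW b0).
have [S SE] := bounded_of_rnorm Sl Sb.
have SEn x : inner (S x) x = (rnorm (Ta x) ^+ 2)%:C.
  by rewrite SE /= TaE inner_rnorm.
have S_inj x : S x = 0 -> x = 0.
  move=> Sx0; apply: Ta_inj; apply/eqP; rewrite -rnorm_eq0 -sqrf_eq0.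
  by rewrite -(inj_eq (@complexI R)) /= -SEn Sx0 inner0l.
(* The step size [t] gives [t |S v|^2 <= |Ta v|^2]; enlarging [c] to [d >= 1/b] keeps
   [1 - t / d ^+ 2] nonnegative. *)
pose d := Num.max c b^-1; pose t := (b ^+ 2)^-1.
have d0 : 0 < d by rewrite lt_max invr_gt0 b0 orbT.
have Td y : rnorm (T y) <= d * rnorm (Ta (T y)).
  apply: le_trans (Tc y) _.
  by rewrite ler_wpM2r ?rnorm_ge0 // le_max lexx.
have t0 : 0 < t by rewrite invr_gt0 exprn_gt0.
have td1 : 0 < t / d ^+ 2 <= 1.
  rewrite divr_gt0 ?exprn_gt0 //= ler_pdivrMr ?exprn_gt0 // mul1r /t -exprVn.
  have bd : b^-1 <= d by rewrite le_max lexx orbT.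
  by rewrite ler_pXn2r ?nnegrE ?(ltW d0) ?invr_ge0 ?(ltW b0).
pose r := Num.sqrt (1 - t / d ^+ 2).
have r01 : 0 <= r < 1.
  rewrite sqrtr_ge0 /= -[ltRHS]sqrtr1 ltr_sqrt //; lra.
pose P x := x - t%:C *: S x.
(* With [v = T y], [|P v|^2 = |v|^2 - 2t |Ta v|^2 + t^2 |S v|^2 <= |v|^2 - t |Ta v|^2], and [Td]
   bounds [|Ta v|] below by [|v| / d]. *)
have P_contr y : rnorm (P (T y)) <= r * rnorm (T y).
  set v := T y; rewrite -(@ler_pXn2r _ 2) ?nnegrE ?mulr_ge0 ?rnorm_ge0 ?sqrtr_ge0 //.
  rewrite exprMn sqr_sqrtr; last by lra.
  rewrite rnormB_sq innerC innerZl SEn rnormZ rnormC ?(ltW t0) // exprMn expr2.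
  rewrite -mulrA -rmorphM /=.
  have h1 : rnorm (S v) ^+ 2 <= b ^+ 2 * rnorm (Ta v) ^+ 2.
    rewrite SE /= -exprMn ler_pXn2r ?nnegrE ?mulr_ge0 ?rnorm_ge0 ?(ltW b0) //.
  have h2 : rnorm v ^+ 2 <= d ^+ 2 * rnorm (Ta v) ^+ 2.
    by rewrite -exprMn ler_pXn2r ?nnegrE ?mulr_ge0 ?rnorm_ge0 ?(ltW d0) //; exact: Td.
  have tb : t * b ^+ 2 = 1 by rewrite mulVf // expf_neq0 // gt_eqF.
  have h3 : t * (t * rnorm (S v) ^+ 2) <= t * rnorm (Ta v) ^+ 2.
    rewrite ler_pM2l // -[leRHS]mul1r -tb -mulrA ler_pM2l //.
  have h4 : t / d ^+ 2 * rnorm v ^+ 2 <= t * rnorm (Ta v) ^+ 2.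
    rewrite -mulrA ler_pM2l // mulrC ler_pdivrMr ?exprn_gt0 // mulrC //.
  by lra.
pose y_ x n := iter n P x.
(* [P] commutes with [S], whose values lie in the range of [T]; so the images [S (y_ x n)] contract
   even if [y_ x n] is outside that range. *)
have SP x : S (P x) = P (S x) by rewrite /P linearB linearZ.
have Sy x n : S (y_ x n) = iter n P (S x).
  by elim: n => // n IH; rewrite /y_ /= SP -/(y_ x n) IH.
have Sy_le x n : rnorm (S (y_ x n)) <= rnorm (S x) * r ^+ n.
  elim: n => [|n IH]; first by rewrite expr0 mulr1.
  have -> : S (y_ x n.+1) = P (T (Ta (y_ x n))) by rewrite /y_ /= SP SE.
  apply: le_trans (P_contr _) _; rewrite exprS mulrCA.
  rewrite ler_wpM2l ?sqrtr_ge0 //; by move: IH; rewrite SE.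
have y_incr x n : rnorm (y_ x n.+1 - y_ x n) <= t * rnorm (S x) * r ^+ n.
  rewrite (_ : _ - _ = - (t%:C *: S (y_ x n))); last first.
    by rewrite /y_ /= /P -/(y_ x n) addrAC subrr add0r.
  by rewrite rnormN rnormZ rnormC ?(ltW t0) // -mulrA ler_pM2l.
(* The limit [l] of the orbit satisfies [S l = 0], so [l = 0], and the tail estimate becomes
   geometric decay of the orbit itself. *)
have y_le x n : rnorm (y_ x n) <= t * rnorm (S x) / (1 - r) * r ^+ n.
  have [l yl ly] := geometric_increments_cvg r01 (y_incr x).
  suff l0 : l = 0 by have := ly n; rewrite l0 sub0r rnormN.
  apply: S_inj; apply: norm_cvg_unique (bounded_cvg yl) _.
  apply/cvg_rnormP => e e0; have := near_geometric_lt (rnorm (S x)) r01 e0.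
  by apply: filterS => m; rewrite sub0r rnormN /=; apply: le_lt_trans.
have y_cvg0 x : y_ x @ \oo --> 0.
  apply/cvg_rnormP => e e0.
  have := near_geometric_lt (t * rnorm (S x) / (1 - r)) r01 e0.
  by apply: filterS => m; rewrite sub0r rnormN; apply: le_lt_trans.
have S_surj x : exists z, S z = x /\
    rnorm z <= t * (t * (b * b) / (1 - r)) / (1 - r) * rnorm x.
  (* Since [t S (y_k) = y_k - y_(k+1)], [S (z n)] telescopes to [x - y_ x n]. The orbit decays
     geometrically, so [z] converges, with a bound linear in [|x|]. *)
  pose z n := \sum_(0 <= k < n) t%:C *: y_ x k.
  have z_incr n : rnorm (z n.+1 - z n) <= t * (t * rnorm (S x) / (1 - r)) * r ^+ n.
    rewrite /z big_nat_recr //= addrAC subrr add0r rnormZ rnormC ?(ltW t0) //.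
    by rewrite -mulrA ler_pM2l.
  have Sz n : S (z n) = x - y_ x n.
    rewrite /z; elim: n => [|n IH]; first by rewrite big_nil linear0 subrr.
    rewrite big_nat_recr //= linearD linearZ /= IH /P opprB -/(y_ x n).
    by rewrite -addrA (addrC (- _)).
  have [l zl lz] := geometric_increments_cvg r01 z_incr.
  exists l; split.
    apply: norm_cvg_unique (bounded_cvg zl) _.
    apply/cvg_rnormP => e e0; have /cvg_rnormP/(_ e e0) := y_cvg0 x.
    by apply: filterS => n /=; rewrite Sz subKr sub0r rnormN.
  have := lz 0%N; rewrite /z big_nil subr0 expr0 mulr1 => h; apply: le_trans h _.
  have -> : t * (t * (b * b) / (1 - r)) / (1 - r) * rnorm x =
      t * (t * (b * b * rnorm x) / (1 - r)) / (1 - r) by field; lra.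
  have r1 : 0 <= (1 - r)^-1 by rewrite invr_ge0; lra.
  do ![apply: ler_wpM2r => // | apply: ler_wpM2l; first exact: ltW].
  by rewrite SE; exact: Sb.
(* The chosen preimages depend linearly on [x] because [S] is injective; [Ta \o g] is then the right
   inverse. *)
have [g gP] := choice S_surj.
have Sg x : S (g x) = x by case: (gP x).
have gl : linear g.
  move=> a x y; apply/eqP; rewrite -subr_eq0; apply/eqP; apply: S_inj.
  by rewrite linearB /= linearP /= !Sg subrr.
have Dl : linear (Ta \o g) by move=> a x y /=; rewrite gl Tal.
pose e := t * (t * (b * b) / (1 - r)) / (1 - r).
have Db x : rnorm ((Ta \o g) x) <= b * e * rnorm x.
  by apply: le_trans (Tab _) _; rewrite -mulrA ler_pM2l //; case: (gP x).
have [D DE] := bounded_of_rnorm Dl Db.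
by exists D => x; rewrite DE -[RHS]Sg SE.
Qed.

End RightInverse.

(** * Orthonormal bases of subspaces in finite dimension *)

Section OrthonormalBasis.
Variables (R : realType) (U : hilbertType R).
Local Notation C := R[i].
Implicit Types (V : set U) (v : nat -> U).

Definition orthonormal v (n : nat) :=
  forall i j, (i < n)%N -> (j < n)%N -> inner (v i) (v j) = (i == j)%:R.

Lemma inner_orthonormal_sum v n (a : 'I_n -> C) (j : 'I_n) : orthonormal v n ->
  inner (\sum_(i < n) a i *: v i) (v j) = a j.
Proof.
move=> ov; rewrite inner_suml (bigD1 j) //= big1 ?addr0.
  by rewrite innerZl ov // eqxx mulr1.
by move=> i ij; rewrite innerZl ov // (inj_eq val_inj) (negbTE ij) mulr0.
Qed.

(** If [m > n], the [m] by [n] matrix of coefficients has a nonzero left kernel vector [c]; then [c]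
    combines the [v i] to 0, and pairing with each [v j] forces [c = 0]. *)
Lemma orthonormal_size v m n (e : 'I_n -> U) : orthonormal v m ->
  (forall x : U, exists a : 'I_n -> C, x = \sum_(i < n) a i *: e i) -> (m <= n)%N.
Proof.
move=> ov /(_ _)/cid-span; rewrite leqNgt; apply/negP => nm.
pose A := \matrix_(i < m, j < n) sval (span (v i)) j.
have vE (i : 'I_m) : v i = \sum_(j < n) A i j *: e j.
  by rewrite [LHS](svalP (span (v i))); apply: eq_bigr => j _; rewrite mxE.
have : kermx A != 0.
  rewrite kermx_eq0 /row_free neq_ltn (leq_ltn_trans (rank_leq_col A)) //.
rewrite -nz_row_eq0 => c0; have /sub_kermxP cA := nz_row_sub (kermx A).
set c := nz_row _ in c0 cA.
suff : c = 0 by apply/eqP.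
apply/rowP => j; rewrite mxE -(inner_orthonormal_sum (c 0) j ov).
rewrite (_ : \sum_i _ = 0) ?inner0l //.
under eq_bigr => i _ do rewrite vE scaler_sumr.
rewrite exchange_big big1 //= => k _.
under eq_bigr => i _ do rewrite scalerA.
have := congr1 (fun B : 'rV_n => B 0 k) cA.
by rewrite -scaler_suml !mxE => ->; rewrite scale0r.
Qed.

Lemma orthonormal_basis V : finite_dim U -> V 0 ->
  (forall a x y, V x -> V y -> V (a *: x + y)) ->
  exists (n : nat) v, [/\ forall i, (i < n)%N -> V (v i), orthonormal v n &
    forall x, V x -> x = \sum_(i < n) inner x (v i) *: v i].
Proof.
move=> [N [e span]] V0 VD.
have VS m (f : 'I_m -> U) : (forall i, V (f i)) -> V (\sum_i f i).
  move=> Vf; elim/big_ind: _ => // x y Vx Vy.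
  by rewrite -[x]scale1r; exact: VD.
have VZ a x : V x -> V (a *: x) by move=> Vx; rewrite -[_ *: _]addr0; exact: VD.
(* Gram-Schmidt with fuel: [k] vectors are found and [m] extensions remain. At [m = 0] there would
   be [N.+1] orthonormal vectors, contradicting [orthonormal_size]. *)
suff H m k : (k + m = N.+1)%N -> forall v, (forall i, (i < k)%N -> V (v i)) ->
    orthonormal v k ->
  exists (n : nat) v, [/\ forall i, (i < n)%N -> V (v i), orthonormal v n &
    forall x, V x -> x = \sum_(i < n) inner x (v i) *: v i].
  exact: (H N.+1 0%N erefl (fun=> 0)).
elim: m k => [|m IH] k kN v Vv ov.
  by have := orthonormal_size ov span; rewrite -(addn0 k) kN ltnn.
have [sp|] := pselect (forall x, V x -> x = \sum_(i < k) inner x (v i) *: v i).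
  by exists k, v.
move=> /existsNP[x /not_implyP[Vx /eqP]].
set s := \sum_(i < k) _ => xs.
pose r := x - s; have r0 : rnorm r != 0 by rewrite rnorm_eq0 subr_eq0.
have Vr : V r.
  rewrite /r addrC -scaleN1r; apply: VD => //.
  by apply: VS => i; apply: VZ; exact: Vv.
have rv j : (j < k)%N -> inner r (v j) = 0.
  move=> jk; rewrite /r innerDl innerNl.
  by rewrite (inner_orthonormal_sum (fun i : 'I_k => inner x (v i)) (Ordinal jk) ov) subrr.
pose u := (rnorm r)^-1%:C *: r.
have uv j : (j < k)%N -> inner u (v j) = 0.
  by move=> jk; rewrite innerZl rv // mulr0.
have uu : inner u u = 1.
  rewrite inner_rnorm rnormZ rnormC ?invr_ge0 ?rnorm_ge0 //.
  by rewrite mulVf // expr1n.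
apply: (IH k.+1 _ (fun i => if i == k then u else v i)); first by rewrite addSnnS.
  move=> i; rewrite ltnS leq_eqVlt; have [-> _|_] := eqVneq i k; last exact: Vv.
  exact: VZ.
move=> i j; rewrite !ltnS (leq_eqVlt i) (leq_eqVlt j).
have [->|ik] := eqVneq i k; have [->|jk] := eqVneq j k => //=.
- by move=> _ jk'; rewrite uv.
- by move=> ik' _; rewrite innerC uv // conjC0 (negbTE ik).
- exact: ov.
Qed.

End OrthonormalBasis.

(** * Synthesis operators and their explicit adjoints *)

Section Synthesis.
Variable R : realType.
Local Notation C := R[i].
Local Notation Re := complex.Re.
Local Notation Im := complex.Im.

Lemma Re_le_rnorm (a : C) : `|Re a| <= rnorm a.
Proof.
rewrite -(@ler_pXn2r _ 2) ?nnegrE ?rnorm_ge0 // real_normK ?num_real //.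
by rewrite rnorm_sq lerDl sqr_ge0.
Qed.

Lemma Im_le_rnorm (a : C) : `|Im a| <= rnorm a.
Proof.
rewrite -(@ler_pXn2r _ 2) ?nnegrE ?rnorm_ge0 // real_normK ?num_real //.
by rewrite rnorm_sq lerDr sqr_ge0.
Qed.

Section Inner.
Variable X : hilbertType R.

(** [g] stands for the real or imaginary part, which [ell2_inner] sums as separate real series. *)
Lemma inner_cvg_part (g : C -> R) (y : nat -> X) (l z : X) :
  {morph g : a b / a - b} -> (forall a, `|g a| <= rnorm a) ->
  y @ \oo --> l ->
  (fun n => g (inner (y n) z)) @ \oo --> g (inner l z).
Proof.
move=> gB gle /cvg_rnormP yl; apply/cvgrPdist_lt => e e0.
have e0' : 0 < e / (rnorm z + 1) by rewrite divr_gt0 // ltr_wpDl ?rnorm_ge0.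
have := yl _ e0'; apply: filterS => n; rewrite -gB -innerNl -innerDl => h.
apply: le_lt_trans (gle _) _; apply: le_lt_trans (Cauchy_Schwarz _ _) _.
have z0 : 0 < rnorm z + 1 by rewrite ltr_wpDl ?rnorm_ge0.
rewrite ltr_pdivlMr // in h; apply: le_lt_trans h.
by rewrite ler_wpM2l ?rnorm_ge0 // lerDl.
Qed.

End Inner.

Lemma delta_sqsummable (k : nat) : (fun j => (j == k)%:R) \in @sqsummable R.
Proof.
apply/sqsummableP; exists 1 => n.
suff -> : \sum_(0 <= j < n) rnorm ((j == k)%:R : C) ^+ 2 = (k < n)%:R by case: ltnP.
elim: n => [|n IH]; first by rewrite big_nil.
rewrite big_nat_recr //= IH ltnS (leq_eqVlt k n) eq_sym.
have [->|nk] := eqVneq n k; first by rewrite ltnn /= rnormC // expr1n add0r.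
by rewrite /= rnorm0 expr0n addr0.
Qed.

Definition ell2_delta (k : nat) : ell2 R := Ell2 (delta_sqsummable k).

Section SynthesisOperator.
Variables (X : hilbertType R) (eta : nat -> X).
Implicit Types T : {bounded ell2 R -> X}.

Lemma synthesis_delta T k : synthesis_operator eta T -> T (ell2_delta k) = eta k.
Proof.
move=> /(_ (ell2_delta k)) h; apply: norm_cvg_unique h _.
have E n : \sum_(0 <= j < n) ell2_delta k j *: eta j = (k < n)%:R *: eta k.
  elim: n => [|n IH]; first by rewrite big_nil scale0r.
  rewrite big_nat_recr //= IH ltnS (leq_eqVlt k n) eq_sym.
  have [->|nk] := eqVneq n k; first by rewrite ltnn /= scale0r add0r scale1r.
  by rewrite scale0r addr0.
apply/cvg_rnormP => e e0; exists k.+1 => // n /= kn.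
by rewrite /series /= E kn scale1r subrr rnorm0.
Qed.

Lemma analysis_sqsummable (z : X) : bessel eta ->
  (fun k => inner z (eta k)) \in @sqsummable R.
Proof. by move=> [a a0 /(_ z) h]; apply: le_lt_trans h _; exact: ltry. Qed.

Definition analysis (be : bessel eta) (z : X) : ell2 R :=
  Ell2 (analysis_sqsummable z be).

(** The identity holds for finite partial sums and passes to the limit by continuity of the inner
    product. *)
Lemma synthesis_analysis T (be : bessel eta) : synthesis_operator eta T ->
  adjoint_pair T (analysis be).
Proof.
move=> sT w z.
set v := analysis be z; have [cr ci] := pairing_is_cvg (ell2P w) (ell2P v).
have E n : inner (series (fun k => w k *: eta k) n) z = \sum_(0 <= k < n) w k * (v k)^*.
  rewrite /series /=; elim: n => [|n IH]; first by rewrite !big_nil inner0l.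
  by rewrite !big_nat_recr //= innerDl IH innerZl (innerC z).
have part (g : C -> R) : {morph g : a b / a - b} -> (forall a, `|g a| <= rnorm a) ->
    g 0 = 0 -> cvgn (series (fun k => g (w k * (v k)^*))) ->
    g (inner (T w) z) = limn (series (fun k => g (w k * (v k)^*))).
  move=> gB gle g0 cg.
  have gD a b : g (a + b) = g a + g b.
    have gN : g (- b) = - g b by rewrite -[- b]add0r gB g0 sub0r.
    by rewrite -{1}[b]opprK gB gN opprK.
  apply/esym/cvg_lim => //.
  have := @inner_cvg_part _ g _ _ z gB gle (sT w).
  rewrite (_ : (fun n => _) = series (fun k => g (w k * (v k)^*))) //.
  apply/funext => n; rewrite E /series /=; elim: n => [|n IH].
    by rewrite !big_nil.
  by rewrite !big_nat_recr //= -IH gD.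
rewrite [RHS](_ : _ = ell2_inner w v) // /ell2_inner.
rewrite -(part (fun a => Re a)) //; first rewrite -(part (fun a => Im a)) //; first by case: (inner _ _).
- by move=> [? ?] [? ?].
- exact: Im_le_rnorm.
- by move=> [? ?] [? ?].
- exact: Re_le_rnorm.
Qed.

(** The analysis operator witnesses that the set in [adjoint] is inhabited, so the default 0 of
    [xget] is not taken; uniqueness identifies the two. *)
Lemma adjoint_synthesis T (be : bessel eta) : synthesis_operator eta T ->
  adjoint T = analysis be.
Proof.
move=> sT; apply/funext => z.
have : [set v | forall y, inner (T y) z = inner y v] (adjoint T z).
  by apply: xgetPex; exists (analysis be z) => w; exact: synthesis_analysis.
by move=> h; apply: inner_inj => w; rewrite -h; exact: synthesis_analysis.
Qed.

Lemma analysis_rnorm (be : bessel eta) (z : X) :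
  (\sum_(0 <= k <oo) (rnorm (inner z (eta k)) ^+ 2)%:E =
  (rnorm (analysis be z) ^+ 2)%:E)%E.
Proof.
have -> : rnorm (analysis be z) ^+ 2 =
    limn (series (fun k => rnorm (inner z (eta k)) ^+ 2)).
  by apply: complexI; rewrite -inner_rnorm [LHS]ell2_innerE.
rewrite -EFin_lim; last exact: sqsummable_cvg (analysis_sqsummable z be).
by congr (limn _); apply/funext => n; rewrite /= sumEFin.
Qed.

End SynthesisOperator.
End Synthesis.

(** * Data-compatible pairs, closed loops and frame bounds *)

Section DataDriven.
Variable R : realType.
Local Notation C := R[i].
Implicit Types X U Y : hilbertType R.

(** Source of the operators of rank at most one used as perturbations of a data-compatible pair. *)
Lemma bounded_inner_scale X U Y (f : X -> U) (b : R) (q : U) (z : Y) :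
  linear f -> (forall x, rnorm (f x) <= b * rnorm x) ->
  {F : {bounded X -> Y} | forall x, F x = inner (f x) q *: z}.
Proof.
move=> fl fb.
have gl : linear (fun x => inner (f x) q *: z).
  by move=> a x y; rewrite fl innerDl innerZl scalerDl scalerA.
have gb x : rnorm (inner (f x) q *: z) <= b * rnorm q * rnorm z * rnorm x.
  rewrite rnormZ (_ : _ * rnorm x = b * rnorm x * rnorm q * rnorm z); last by ring.
  rewrite ler_wpM2r ?rnorm_ge0 //; apply: le_trans (Cauchy_Schwarz _ _) _.
  by rewrite ler_wpM2r ?rnorm_ge0.
by have [F FE] := bounded_of_rnorm gl gb; exists F.
Qed.

Lemma bounded_comp_rnorm X U Y (F : {bounded U -> Y}) (G : {bounded X -> U}) :
  exists b : R, forall x, rnorm (F (G x)) <= b * rnorm x.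
Proof.
have [a a0 Fa] := bounded_rnorm F; have [b _ Gb] := bounded_rnorm G.
exists (a * b) => x; apply: le_trans (Fa _) _.
by rewrite -mulrA ler_pM2l.
Qed.

(** Both sides are limits of the same partial sums, as [A] and [B] are continuous. *)
Lemma synthesis_Sigma X U (x1 x0 : nat -> X) (u0 : nat -> U) T1 T0 Tu
    (A : {bounded X -> X}) (B : {bounded U -> X}) :
  synthesis_operator x1 T1 -> synthesis_operator x0 T0 ->
  synthesis_operator u0 Tu -> Sigma_is x1 x0 u0 (A, B) ->
  forall w, T1 w = A (T0 w) + B (Tu w).
Proof.
move=> s1 s0 su AB w; apply: norm_cvg_unique (s1 w) _.
suff -> : series (fun k => w k *: x1 k) =
    (A \o series (fun k => w k *: x0 k)) \+ (B \o series (fun k => w k *: u0 k)).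
  by apply: cvgD; exact: bounded_cvg.
apply/funext => n; rewrite /series /=.
rewrite !linear_sum -big_split; apply: eq_bigr => k _ /=.
by rewrite !linearZ /= -scalerDr AB.
Qed.

(** Moving adjoints across, the quadratic forms of [Ta T] and of its square at [y] are [|T y|^2] and
    [|Ta (T y)|^2]. *)
Lemma op_le_gramP X Y (T : {bounded Y -> X}) Ta (c : R) : adjoint_pair T Ta ->
  op_le (Ta \o T) (fun y => (c ^+ 2)%:C *: (Ta \o T) ((Ta \o T) y)) <->
  forall y, rnorm (T y) ^+ 2 <= c ^+ 2 * rnorm (Ta (T y)) ^+ 2.
Proof.
move=> TaE.
have TaE' x y : inner (Ta x) y = inner x (T y) by rewrite innerC -TaE -innerC.
have E y : inner ((c ^+ 2)%:C *: Ta (T (Ta (T y))) - Ta (T y)) y =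
    (c ^+ 2 * rnorm (Ta (T y)) ^+ 2 - rnorm (T y) ^+ 2)%:C.
  rewrite innerDl innerNl innerZl !TaE' TaE !inner_rnorm.
  by rewrite -rmorphM -rmorphB.
by split=> h y; have := h y; rewrite /= E lecR subr_ge0.
Qed.

(* A perturbation of a data-compatible pair along a pair annihilating the data
   can be scaled arbitrarily, while the bound on [A + B K] stays fixed. *)
Lemma annihilator_closed_loop X U (x1 x0 : nat -> X) (u0 : nat -> U)
    (K : {bounded X -> U}) (M gamma : R)
    (A A0 : {bounded X -> X}) (B B0 : {bounded U -> X}) :
  Sigma_is x1 x0 u0 (A, B) ->
  Sigma_is x1 x0 u0 `<=` Sigma_stab K M gamma ->
  (forall k, A0 (x0 k) + B0 (u0 k) = 0) ->
  forall x, A0 x + B0 (K x) = 0.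
Proof.
move=> AB sub AB0.
pose F x := A x + B (K x); pose E x := A0 x + B0 (K x).
(* Only the first power of the closed loop is used: its bound does not depend on [t]. *)
have bd t x : rnorm x <= 1 -> rnorm (F x + t%:C *: E x) <= M * gamma ^+ 1.
  move=> x1'.
  have comb Y Z (G G0 : {bounded Y -> Z}) :
      {G' : {bounded Y -> Z} | forall y, G' y = G y + t%:C *: G0 y}.
    have l : linear (fun y => G y + t%:C *: G0 y).
      move=> a y z; rewrite !linearP !scalerDr !scalerA (mulrC a) /=.
      by rewrite addrACA.
    suff /cid[b Gb] : exists b : R, forall y, rnorm (G y + t%:C *: G0 y) <= b * rnorm y.
      by have [G' G'E] := bounded_of_rnorm l Gb; exists G'.
    have [b _ Gb] := bounded_rnorm G; have [b0 _ Gb0] := bounded_rnorm G0.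
    exists (b + rnorm (t%:C : C) * b0) => y; apply: le_trans (ler_rnormD _ _) _.
    by rewrite mulrDl lerD // rnormZ -mulrA ler_wpM2l ?rnorm_ge0.
  have [A' A'E] := comb _ _ A A0; have [B' B'E] := comb _ _ B B0.
  have /sub/(_ 1%N) : Sigma_is x1 x0 u0 (A', B').
    move=> k; rewrite /= A'E B'E AB /= addrACA -scalerDr AB0 scaler0 addr0 //.
  apply: le_trans => /=.
  have -> : F x + t%:C *: E x = A' x + B' (K x).
    by rewrite A'E B'E /F /E scalerDr addrACA.
  have [a _ Aa] := bounded_rnorm A'; have [b BKb] := bounded_comp_rnorm B' K.
  apply: (@le_opnorm _ _ _ (iter 1 (fun y => A' y + B' (K y))) (a + b)) => // y /=.
  by apply: le_trans (ler_rnormD _ _) _; rewrite mulrDl lerD.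
have E0 x : rnorm x <= 1 -> E x = 0.
  move=> x1'; apply/eqP; rewrite -rnorm_eq0; apply/negPn/negP => Ex0.
  have Ep : 0 < rnorm (E x) by rewrite lt_neqAle eq_sym Ex0 rnorm_ge0.
  pose L := M * gamma ^+ 1 + rnorm (F x).
  have L0 : 0 <= L.
    by rewrite addr_ge0 ?rnorm_ge0 // (le_trans _ (bd 0 x x1')) ?rnorm_ge0.
  (* Chosen so that [|t E x| = L + 1], while [bd] and the triangle inequality give at most [L]. *)
  pose t := (L + 1) / rnorm (E x).
  have t0 : 0 <= t by rewrite divr_ge0 ?rnorm_ge0 //; lra.
  have : rnorm (t%:C *: E x) <= L.
    rewrite -[X in rnorm X](addKr (F x)) addrC.
    apply: le_trans (ler_rnormD _ _) _; rewrite rnormN /L lerD //; exact: bd.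
  by rewrite rnormZ rnormC // divfK //; lra.
move=> x; pose s := rnorm x + 1.
have s0 : 0 < s by rewrite ltr_wpDl ?rnorm_ge0.
have sC : s%:C != 0 :> C by rewrite (inj_eq (@complexI R)) gt_eqF.
have EZ a y : E (a *: y) = a *: E y by rewrite /E !linearZ /= -scalerDr.
have : E (s^-1%:C *: x) = 0.
  apply: E0; rewrite rnormZ rnormC ?invr_ge0 ?(ltW s0) //.
  by rewrite mulrC ler_pdivrMr // mul1r lerDl.
by rewrite EZ => /eqP; rewrite scaler_eq0 fmorphV invr_eq0 (negbTE sC) => /eqP.
Qed.

(** From [|y|^2 = <T (D y), y> = <D y, Ta y> <= b |y| |Ta y|], where [Ta] is the analysis operator,
    [b^-2] is a lower frame bound. *)
Lemma frame_of_right_inverse X (eta : nat -> X) (T : {bounded ell2 R -> X})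
    (D : {bounded X -> ell2 R}) :
  synthesis_operator eta T -> bessel eta -> cancel D T -> frame eta.
Proof.
move=> sT be DK; have [a a0 etaa] := be; have [b b0 Db] := bounded_rnorm D.
exists a, (b ^+ 2)^-1; split; rewrite ?invr_gt0 ?exprn_gt0 // => y.
rewrite etaa andbT (analysis_rnorm be) lee_fin mulrC ler_pdivrMr ?exprn_gt0 //.
rewrite -exprMn ler_pXn2r ?nnegrE ?mulr_ge0 ?rnorm_ge0 ?(ltW b0) //.
have [->|y0] := eqVneq y 0.
  by rewrite rnorm0 mulr_ge0 ?rnorm_ge0 ?(ltW b0).
have yp : 0 < rnorm y by rewrite lt_neqAle rnorm_ge0 andbT eq_sym rnorm_eq0.
rewrite -(ler_pM2l yp) -expr2.
have -> : rnorm y ^+ 2 = rnorm (inner (D y) (analysis be y)).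
  by rewrite -(synthesis_analysis be sT) DK inner_rnorm rnormC // sqr_ge0.
apply: le_trans (Cauchy_Schwarz _ _) _.
rewrite (_ : _ * (_ * b) = b * rnorm y * rnorm (analysis be y)); last by ring.
by rewrite ler_wpM2r ?rnorm_ge0.
Qed.

Lemma frame_gram_le X (eta : nat -> X) (T : {bounded ell2 R -> X})
    (be : bessel eta) : frame eta ->
  exists2 c : R, 0 <= c & forall w,
    rnorm (T w) ^+ 2 <= c ^+ 2 * rnorm (analysis be (T w)) ^+ 2.
Proof.
move=> [a [b [a0 b0 eb]]]; exists (Num.sqrt b^-1); first exact: sqrtr_ge0.
move=> w; rewrite sqr_sqrtr ?invr_ge0 ?(ltW b0) // mulrC ler_pdivlMr // mulrC.
by have /andP[+ _] := eb (T w); rewrite (analysis_rnorm be) lee_fin.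
Qed.

(* [D] is corrected on the finite-dimensional image of [ker T] under [S]. *)
Lemma right_inverse_factor X U Y (T : {bounded Y -> X}) (S : {bounded Y -> U})
    (K : {bounded X -> U}) (D : {bounded X -> Y}) :
  finite_dim U -> cancel D T ->
  (forall q, (forall y, T y = 0 -> inner (S y) q = 0) ->
    forall x, inner (K x - S (D x)) q = 0) ->
  exists2 D' : {bounded X -> Y}, cancel D' T & forall x, S (D' x) = K x.
Proof.
move=> fU DK ann.
pose V := [set u | exists2 y, T y = 0 & S y = u].
have V0 : V 0 by exists 0; rewrite linear0.
have VD a u v : V u -> V v -> V (a *: u + v).
  move=> [y Ty <-] [y' Ty' <-]; exists (a *: y + y'); rewrite linearP //=.
  by rewrite Ty Ty' scaler0 addr0.
have [n [v [Vv ov Vspan]]] := orthonormal_basis fU V0 VD.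
(* Lifts of the basis vectors to [ker T]: adding them to [D x] changes [S] without changing [T]. *)
have /choice[w wP] : forall i : 'I_n, exists y, T y = 0 /\ S y = v i.
  by move=> i; have [y] := Vv i (ltn_ord i); exists y.
pose E x := K x - S (D x).
have El : linear E.
  move=> a x x'; rewrite /E linearP (linearP D) /= linearP /=.
  by rewrite scalerBr opprD addrACA.
have Eb : exists b, forall x, rnorm (E x) <= b * rnorm x.
  have [a _ Ka] := bounded_rnorm K; have [b SDb] := bounded_comp_rnorm S D.
  exists (a + b) => x; apply: le_trans (ler_rnormD _ _) _.
  by rewrite rnormN mulrDl lerD.
have [b Eb'] := Eb.
(* The residual [q] of projecting [E x] is orthogonal to [V], so [ann] makes it orthogonal to [E x]
   too, hence to itself. *)
have Espan x : E x = \sum_(i < n) inner (E x) (v i) *: v i.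
  set s := \sum_(i < n) _; pose q := E x - s.
  have qv (i : 'I_n) : inner q (v i) = 0.
    rewrite /q innerDl innerNl.
    by rewrite (inner_orthonormal_sum (fun i => inner (E x) (v i)) i ov) subrr.
  have sq (f : 'I_n -> C) : inner (\sum_(i < n) f i *: v i) q = 0.
    rewrite inner_suml big1 // => i _.
    by rewrite innerZl innerC qv conjC0 mulr0.
  have Eq : inner (E x) q = 0.
    by apply: ann => y Ty; rewrite (Vspan (S y)) ?sq //; exists y.
  apply/eqP; rewrite -subr_eq0 -/q -inner_eq0 {1}/q innerDl innerNl Eq sq.
  by rewrite oppr0 addr0.
pose G x := D x + \sum_(i < n) inner (E x) (v i) *: w i.
have Gl : linear G.
  move=> a x x'; rewrite /G linearP scalerDr addrACA; congr (_ + _).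
  rewrite scaler_sumr -big_split; apply: eq_bigr => i _ /=.
  by rewrite El innerDl innerZl scalerDl scalerA.
have [d d0 Dd] := bounded_rnorm D.
have Gb x : rnorm (G x) <=
    (d + \sum_(i < n) b * rnorm (v i) * rnorm (w i)) * rnorm x.
  apply: le_trans (ler_rnormD _ _) _; rewrite mulrDl lerD //.
  apply: le_trans (ler_rnorm_sum _) _; rewrite mulr_suml; apply: ler_sum => i _.
  rewrite rnormZ (_ : _ * rnorm x = b * rnorm x * rnorm (v i) * rnorm (w i));
    last by ring.
  rewrite ler_wpM2r ?rnorm_ge0 //; apply: le_trans (Cauchy_Schwarz _ _) _.
  by rewrite ler_wpM2r ?rnorm_ge0.
have [D' D'E] := bounded_of_rnorm Gl Gb; exists D' => x; rewrite D'E /G.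
  rewrite linearD /= DK linear_sum big1 /= ?addr0 // => i _.
  by rewrite linearZ /= (wP i).1 scaler0.
rewrite linearD linear_sum /=.
under eq_bigr => i _ do rewrite linearZ /= (wP i).2.
by rewrite -Espan addrC subrK.
Qed.

End DataDriven.

(** * From informativity to a stable right inverse, and back *)

Theorem theorem6p2 (R : realType) (X U : hilbertType R)
  (X_nontrivial : nontrivial X) (U_nontrivial : nontrivial U)
  (U_findim : finite_dim U)
  (As : {bounded X -> X}) (Bs : {bounded U -> X})
  (x1 x0 : nat -> X) (u0 : nat -> U)
  (x1_bessel : bessel x1) (x0_bessel : bessel x0) (u0_bessel : bessel u0)
  (x1E : forall k : nat, x1 k = As (x0 k) + Bs (u0 k))
  (Xi1 Xi0 : {bounded ell2 R -> X}) (Ups0 : {bounded ell2 R -> U})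
  (Xi1_synth : synthesis_operator x1 Xi1)
  (Xi0_synth : synthesis_operator x0 Xi0)
  (Ups0_synth : synthesis_operator u0 Ups0)
  (gamma : R) (gamma_gt0 : 0 < gamma) (gamma_lt1 : gamma < 1) :
  (informative x1 x0 u0 gamma /\
   exists2 c : R, 0 <= c &
     op_le (adjoint Xi0 \o Xi0)
           (fun w : ell2 R =>
              (c ^+ 2)%:C *: (adjoint Xi0 \o Xi0) ((adjoint Xi0 \o Xi0) w)))
  <->
  (frame x0 /\
   exists2 Xi0d : {bounded X -> ell2 R},
     cancel Xi0d Xi0 & power_stable gamma (Xi1 \o Xi0d)).
Proof.
rewrite (adjoint_synthesis x0_bessel Xi0_synth).
have TaE := synthesis_analysis x0_bessel Xi0_synth.
set Ta := analysis x0_bessel in TaE *.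
split=> [[[K [M [M1 sub]]] [c c0 /(op_le_gramP c TaE) cP]] | [fr [D DK [M M1 st]]]].
- have AB : Sigma_is x1 x0 u0 (As, Bs) by [].
  have [z z0] := X_nontrivial.
  have ann (A0 : {bounded X -> X}) (B0 : {bounded U -> X}) :=
    annihilator_closed_loop (A0 := A0) (B0 := B0) AB sub.
  have idl (Y : hilbertType R) : linear (@idfun Y) by move=> ? ? ?.
  have idb (Y : hilbertType R) (y : Y) : rnorm (idfun y) <= 1 * rnorm y by rewrite mul1r.
  have Ta_inj p : Ta p = 0 -> p = 0.
    (* Take [A0 x = <x,p> z] and [B0 = 0]. The data are annihilated because
       [<x0 k, p> = <delta_k, Ta p> = 0]; at [p] the closed loop gives [|p|^2 z = 0]. *)
    move=> Tap; have [A0 A0E] := bounded_inner_scale p z (idl X) (idb X).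
    have [B0 B0E] := bounded_inner_scale 0 z (idl U) (idb U).
    have : A0 p + B0 (K p) = 0.
      apply: ann => k; rewrite A0E B0E inner0r scale0r addr0 /=.
      by rewrite -(synthesis_delta k Xi0_synth) TaE Tap inner0r scale0r.
    rewrite A0E B0E inner0r scale0r addr0 /= => /eqP.
    by rewrite scaler_eq0 (negbTE z0) orbF inner_eq0 => /eqP.
  have Tc w : rnorm (Xi0 w) <= c * rnorm (Ta (Xi0 w)).
    rewrite -(@ler_pXn2r _ 2) ?nnegrE ?mulr_ge0 ?rnorm_ge0 //.
    by rewrite exprMn; exact: cP.
  have [D DK] := right_inverse_of_lower_bound TaE Ta_inj Tc.
  have [D' D'K D'E] : exists2 D' : {bounded X -> ell2 R}, cancel D' Xi0 &
      forall x, Ups0 (D' x) = K x.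
    apply: (right_inverse_factor U_findim DK) => q qV x.
    have UDl : linear (Ups0 \o D) by move=> a y y' /=; rewrite (linearP D) /= linearP.
    have [b UDb] := bounded_comp_rnorm Ups0 D.
    (* The closed loop of this pair is [<K x - Ups0 (D x), q> z]. On the data it gives
       [<Ups0 (delta_k - D (x0 k)), q> z], which vanishes since [delta_k - D (x0 k)] lies in
       [ker Xi0]. *)
    have [A0 A0E] := bounded_inner_scale (- q) z UDl UDb.
    have [B0 B0E] := bounded_inner_scale q z (idl U) (idb U).
    have : A0 x + B0 (K x) = 0.
      apply: ann => k; rewrite A0E B0E /= innerNr -scalerDl.
      rewrite -(synthesis_delta k Xi0_synth) -(synthesis_delta k Ups0_synth).
      rewrite addrC -innerNl -innerDl -linearB qV ?scale0r //.
      by rewrite linearB /= DK subrr.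
    rewrite A0E B0E /= innerNr -scalerDl => /eqP.
    rewrite scaler_eq0 (negbTE z0) orbF addrC -innerNl -innerDl => /eqP //.
  split; first exact: frame_of_right_inverse Xi0_synth x0_bessel D'K.
  exists D' => //; exists M => // k; have := sub _ AB k.
  suff -> : Xi1 \o D' = (fun x => As x + Bs (K x)) by [].
  apply/funext => x /=.
  by rewrite (synthesis_Sigma Xi1_synth Xi0_synth Ups0_synth AB) D'K D'E.
- split; last first.
    by have [c c0 cP] := frame_gram_le Xi0 x0_bessel fr; exists c => //; apply/op_le_gramP.
  have Kl : linear (Ups0 \o D) by move=> a y y' /=; rewrite (linearP D) /= linearP.
  have [b Kb] := bounded_comp_rnorm Ups0 D.
  have [K KE] := bounded_of_rnorm Kl Kb.
  (* All compatible pairs share one closed loop, so the constant [M] of [Xi1 \o D] is uniform. *)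
  exists K, M; split=> // -[A B] AB k; rewrite /=.
  suff -> : (fun x => A x + B (K x)) = Xi1 \o D by exact: st.
  apply/funext => x /=.
  by rewrite (synthesis_Sigma Xi1_synth Xi0_synth Ups0_synth AB) DK KE.
Qed.
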